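(* For any $\Gamma$-contraction $(S,P)$ acting on a Hilbert space $\mathcal H$, there exist a Hilbert space $\mathcal K$ containing $\mathcal H$ as a closed linear subspace and a pair of commuting operators $T_1,T_2$ on $\mathcal K$ such that (i) $(T_1+T_2,\,T_1T_2)$ is a $\Gamma$-contraction; (ii) $\mathcal H$ is a joint reducing subspace for $T_1+T_2$ and $T_1T_2$; (iii) $(T_1+T_2)|_{\mathcal H}=S$ and $(T_1T_2)|_{\mathcal H}=P$; (iv) $\max\{\|T_1\|,\|T_2\|\}\leq 2$.
   Context: All operators are bounded linear operators on complex Hilbert spaces. The closed symmetrized bidisc is $\Gamma=\{(z_1+z_2,\,z_1z_2) : z_1,z_2\in\mathbb C,\ |z_1|\leq 1,\ |z_2|\leq 1\}\subset\mathbb C^2$. A pair of commuting operators $(S,P)$ on a Hilbert space is called a $\Gamma$-contraction if $\Gamma$ is a spectral set for $(S,P)$, that is, the Taylor joint spectrum $\sigma_T(S,P)$ is contained in $\Gamma$ and $\|f(S,P)\|\leq \sup_{(z_1,z_2)\in\Gamma}|f(z_1,z_2)|$ for all rational functions $f=p/q$ with $p,q\in\mathbb C[z_1,z_2]$ and $q$ having no zero in $\Gamma$. *)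

(* Defs.v *)
From HB Require Import structures.
From mathcomp Require Import all_boot all_order all_algebra.
From mathcomp Require Import complex sesquilinear polyXY.
From mathcomp Require Import boolp classical_sets reals topology normedtype.

Set Implicit Arguments.
Unset Strict Implicit.
Unset Printing Implicit Defensive.

Import Order.TTheory GRing.Theory Num.Theory.
Import numFieldNormedType.Exports.

Local Open Scope classical_set_scope.
Local Open Scope ring_scope.
Local Open Scope complex_scope.

HB.mixin Record NormedModule_isHilbert (R : realType) (H : Type)
    of CompleteNormedModule R[i] H := {
  inner : {dot H for Num.conj};
  sqr_norm_inner : forall x : H, `|x| ^+ 2 = inner x x }.

#[short(type="hilbertType")]
HB.structure Definition Hilbert (R : realType) :=
  {H of NormedModule_isHilbert R H & CompleteNormedModule R[i] H}.

(* Norms over R[i] take their values in R[i]; this is the same number in R. *)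
Definition rnorm (R : realType) (V : normedZmodType R[i]) (x : V) : R :=
  complex.Re `|x|.

Section Operators.
Variables (R : realType) (H : hilbertType R).
Implicit Types (S P T F : H -> H) (p q : {poly {poly R[i]}}).

Definition bounded_linear T : Prop :=
  linear T /\ exists M : R, forall x, rnorm (T x) <= M * rnorm x.

Definition opnorm T : R :=
  sup [set rnorm (T x) | x in [set x : H | rnorm x <= 1]].

Definition commuting S P : Prop := S \o P = P \o S.

(* The Koszul complex 0 -> H -> H * H -> H -> 0 of a pair of operators. *)
Definition koszul0 S P (x : H) : H * H := (S x, P x).

Definition koszul1 S P (u : H * H) : H := S u.2 - P u.1.

Definition koszul_exact S P : Prop :=
  [/\ [set x | koszul0 S P x = 0] = [set 0],
      [set u | koszul1 S P u = 0] = range (koszul0 S P)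
    & range (koszul1 S P) = setT].

Definition taylor_spectrum S P : set (R[i] * R[i]) :=
  [set z | ~ koszul_exact (fun x => S x - z.1 *: x) (fun x => P x - z.2 *: x)].

(* p(S, P), the first (outer) variable of p standing for S and the second
   (inner) one for P, as in the scalar evaluation p.[z1, z2] of polyXY. *)
Definition poly_op p S P (x : H) : H :=
  \sum_(i < size p) \sum_(j < size p`_i) p`_i`_j *: iter i S (iter j P x).

(* F = (p / q)(S, P) = p(S, P) q(S, P)^-1, including that q(S, P) has a
   bounded inverse. *)
Definition is_rat_op p q S P F : Prop :=
  exists Qinv : H -> H,
    [/\ bounded_linear Qinv,
        cancel (poly_op q S P) Qinv,
        cancel Qinv (poly_op q S P)
      & F = poly_op p S P \o Qinv].

End Operators.

Definition Gamma (R : realType) : set (R[i] * R[i]) :=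
  [set (z.1 + z.2, z.1 * z.2) |
    z in [set z : R[i] * R[i] | `|z.1| <= 1 /\ `|z.2| <= 1]].
Arguments Gamma : clear implicits.

Definition sup_Gamma (R : realType) (p q : {poly {poly R[i]}}) : R :=
  sup [set rnorm (p.[z.1, z.2] / q.[z.1, z.2]) | z in Gamma R].

(* For q without zeros in Gamma, q(S, P) is invertible as soon as the Taylor
   spectrum is contained in Gamma (spectral mapping), so that requiring
   (p / q)(S, P) to exist does not restrict the class. *)
Definition Gamma_contraction (R : realType) (H : hilbertType R)
    (S P : H -> H) : Prop :=
  [/\ bounded_linear S, bounded_linear P, commuting S P,
      taylor_spectrum S P `<=` Gamma R
    & forall p q : {poly {poly R[i]}},
        (forall z, Gamma R z -> q.[z.1, z.2] != 0) ->
        exists2 F, is_rat_op p q S P F & opnorm F <= sup_Gamma p q].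

(* J identifies H with the closed linear subspace range J of K. *)
Definition closed_embedding (R : realType) (H K : hilbertType R)
    (J : H -> K) : Prop :=
  [/\ linear J, forall x y, inner (J x) (J y) = inner x y
    & closed (range J)].

Definition orthocomplement (R : realType) (K : hilbertType R) (M : set K) :
    set K :=
  [set x | forall y, M y -> inner x y = 0].

(* M and its orthogonal complement are both invariant; M is meant to be a
   closed linear subspace. *)
Definition reducing (R : realType) (K : hilbertType R) (M : set K)
    (T : K -> K) : Prop :=
  T @` M `<=` M /\ T @` orthocomplement M `<=` orthocomplement M.

(* Main.v *)
(* On K = H (+) H put S' = S (+) S, A = S^2 / 4 - P and
     T1 = S' / 2 + D,  T2 = S' / 2 - D  with  D = [[0, I], [A, 0]].
   As D commutes with S' and D^2 = A (+) A, we get T1 + T2 = S' and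
   T1 T2 = S'^2 / 4 - D^2 = P (+) P.  The polynomial s^2 / 4 - p equals
   ((z1 - z2) / 2)^2 at (z1 + z2, z1 z2), hence is bounded by 1 on Gamma; since
   Gamma is a spectral set, the norm of A is at most 1, and so is that of D.
   Likewise S / 2 has norm at most 1, so T1 and T2 have norm at most 2. *)
Require Import Defs.
From HB Require Import structures.
From mathcomp Require Import all_boot all_order all_algebra.
From mathcomp Require Import complex sesquilinear polyXY ring lra.
From mathcomp Require Import boolp classical_sets reals topology normedtype.

Set Implicit Arguments.
Unset Strict Implicit.
Unset Printing Implicit Defensive.
Import Order.TTheory GRing.Theory Num.Theory.
Import numFieldNormedType.Exports.
Local Open Scope classical_set_scope.
Local Open Scope ring_scope.
Local Open Scope complex_scope.

(** * The real-valued norm [rnorm] *)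

Section RealNorm.
Variable R : realType.

Section NormedZmodule.
Variable V : normedZmodType R[i].
Implicit Types x y : V.

(** A norm with values in [R[i]] is real, so taking its real part loses nothing. Inequalities pass
    between [R] and [R[i]] through this identity. *)
Lemma rnormE x : (rnorm x)%:C = `|x|.
Proof. exact/RRe_real/normr_real. Qed.

Lemma rnorm_ge0 x : 0 <= rnorm x.
Proof. by rewrite -lecR rnormE normr_ge0. Qed.

Lemma rnorm0 : rnorm (0 : V) = 0.
Proof. by rewrite /rnorm normr0. Qed.

Lemma rnorm_eq0 x : rnorm x = 0 -> x = 0.
Proof. by move=> x0; apply/eqP; rewrite -normr_eq0 -rnormE x0. Qed.

Lemma ler_rnormD x y : rnorm (x + y) <= rnorm x + rnorm y.
Proof. by rewrite -lecR rmorphD/= !rnormE ler_normD. Qed.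

Lemma rnormN x : rnorm (- x) = rnorm x.
Proof. by rewrite /rnorm normrN. Qed.

End NormedZmodule.

Lemma rnormZ (V : normedModType R[i]) (a : R[i]) (x : V) :
  rnorm (a *: x) = rnorm a * rnorm x.
Proof.
by apply: (@complexI R); rewrite rmorphM/= !rnormE normrZ.
Qed.

End RealNorm.

(** * Minkowski's inequality in the plane *)

Section Minkowski.
Variable R : realType.
Implicit Types a b c d : R.

(** After squaring, only the cross term remains, and Cauchy-Schwarz bounds it. This yields the
    triangle inequality for the norm of a direct sum. *)
Lemma sqrt_sqrDD a b c d : 0 <= a -> 0 <= b -> 0 <= c -> 0 <= d ->
  Num.sqrt ((a + c) ^+ 2 + (b + d) ^+ 2) <=
  Num.sqrt (a ^+ 2 + b ^+ 2) + Num.sqrt (c ^+ 2 + d ^+ 2).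
Proof.
move=> a0 b0 c0 d0.
have h : a * c + b * d <=
    Num.sqrt (a ^+ 2 + b ^+ 2) * Num.sqrt (c ^+ 2 + d ^+ 2).
  rewrite -sqrtrM ?addr_ge0 ?sqr_ge0// -[leLHS]ger0_norm ?addr_ge0 ?mulr_ge0//.
  rewrite -sqrtr_sqr ler_wsqrtr// -subr_ge0.
  (* Lagrange's identity: the defect in Cauchy-Schwarz is a square. *)
  rewrite (_ : _ - _ = (a * d - b * c) ^+ 2) ?sqr_ge0//; ring.
rewrite -(@ler_pXn2r _ 2)// ?nnegrE ?addr_ge0 ?sqrtr_ge0//.
rewrite [leRHS]sqrrD !sqr_sqrtr ?addr_ge0 ?sqr_ge0//.
by move: h; set u := _ * Num.sqrt _; nra.
Qed.

End Minkowski.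

(** * The Hilbert space direct sum of two Hilbert spaces *)

Section DirectSum.
Variables (R : realType) (H1 H2 : hilbertType R).

(** A separate name for the product, since [H1 * H2] itself carries the maximum norm, which does not
    come from an inner product. Only the module structure is copied. *)
Definition hsum : Type := (H1 * H2)%type.

HB.instance Definition _ := GRing.Lmodule.copy hsum (H1 * H2)%type.

Implicit Types x y : hsum.

Definition hsum_norm x : R[i] :=
  (Num.sqrt (rnorm x.1 ^+ 2 + rnorm x.2 ^+ 2))%:C.

Let hsum_normD x y : hsum_norm (x + y) <= hsum_norm x + hsum_norm y.
Proof.
rewrite -rmorphD lecR/=.
apply: le_trans (sqrt_sqrDD _ _ _ _); rewrite ?rnorm_ge0//.
by rewrite ler_wsqrtr// lerD// lerXn2r ?nnegrE ?addr_ge0 ?rnorm_ge0 ?ler_rnormD.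
Qed.

Let hsum_normZ (a : R[i]) x : hsum_norm (a *: x) = `|a| * hsum_norm x.
Proof.
rewrite -rnormE -rmorphM/=; congr (_%:C).
rewrite !rnormZ !exprMn -mulrDr sqrtrM ?sqr_ge0// sqrtr_sqr ger0_norm//.
exact: (@rnorm_ge0 R R[i]).
Qed.

Let hsum_norm_eq0 x : hsum_norm x = 0 -> x = 0.
Proof.
case: x => x1 x2 /complexI/eqP; rewrite sqrtr_eq0/= => h.
have [h1 h2] := (sqr_ge0 (rnorm x1), sqr_ge0 (rnorm x2)).
congr pair; apply/rnorm_eq0/eqP; rewrite -sqrf_eq0; apply/eqP; lra.
Qed.

HB.instance Definition _ :=
  Lmodule_isNormed.Build R[i] hsum hsum_normD hsum_normZ hsum_norm_eq0.

Lemma rnorm_hsum x : rnorm x = Num.sqrt (rnorm x.1 ^+ 2 + rnorm x.2 ^+ 2).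
Proof. by []. Qed.

Lemma sqr_rnorm_hsum x : rnorm x ^+ 2 = rnorm x.1 ^+ 2 + rnorm x.2 ^+ 2.
Proof. by rewrite rnorm_hsum sqr_sqrtr// addr_ge0 ?sqr_ge0. Qed.

Lemma norm_fst_le x : `|x.1| <= `|x|.
Proof.
rewrite -!rnormE lecR rnorm_hsum -[leLHS]ger0_norm ?rnorm_ge0//.
by rewrite -sqrtr_sqr ler_wsqrtr// lerDl sqr_ge0.
Qed.

Lemma norm_snd_le x : `|x.2| <= `|x|.
Proof.
rewrite -!rnormE lecR rnorm_hsum -[leLHS]ger0_norm ?rnorm_ge0//.
by rewrite -sqrtr_sqr ler_wsqrtr// lerDr sqr_ge0.
Qed.

Lemma norm_hsum_le x : `|x| <= `|x.1| + `|x.2|.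
Proof.
rewrite -!rnormE -rmorphD lecR/= rnorm_hsum.
have [h1 h2] := (rnorm_ge0 x.1, rnorm_ge0 x.2).
rewrite -[leRHS]ger0_norm ?addr_ge0//.
rewrite -sqrtr_sqr ler_wsqrtr// sqrrD -addrA lerD2l lerDr.
by rewrite mulrn_wge0 ?mulr_ge0.
Qed.

Let ball_hsum x (e : R[i]) y : ball x e y -> ball x.1 e y.1 /\ ball x.2 e y.2.
Proof.
rewrite -!ball_normE /ball_/= => xy.
split; apply: le_lt_trans xy.
  exact: norm_fst_le (x - y).
exact: norm_snd_le (x - y).
Qed.

(** Both projections are contractive, so they send a Cauchy filter to Cauchy filters. The pair of
    their limits is the limit, because the norm is at most the sum of the norms of the
    coordinates. *)
Let hsum_complete (F : set_system hsum) : ProperFilter F -> cauchy F -> cvg F.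
Proof.
move=> FF /cauchyP Fc.
have [c1 c2] : cauchy (fst @ F) /\ cauchy (snd @ F).
  split; apply/cauchy_exP => e /Fc[x Fx]; [exists x.1|exists x.2];
    by apply: (@filterS _ F _ (ball x e)) => // y /ball_hsum[b1 b2].
have /cauchy_cvg/cvgrPdist_lt cvg1 := c1.
have /cauchy_cvg/cvgrPdist_lt cvg2 := c2.
set l : hsum := (lim (fst @ F), lim (snd @ F)).
apply/cvg_ex; exists l; apply/cvgrPdist_lt => e e0; near=> x.
apply: (le_lt_trans (norm_hsum_le (l - x))); rewrite (splitr e) ltrD//=.
  by near: x; apply: cvg1; rewrite divr_gt0.
by near: x; apply: cvg2; rewrite divr_gt0.
Unshelve. all: by end_near. Qed.

HB.instance Definition _ := Uniform_isComplete.Build hsum hsum_complete.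

Definition hsum_inner x y : R[i] := inner x.1 y.1 + inner x.2 y.2.

Let hsum_inner_bilinear : @bilinear_for R[i] hsum hsum R[i]
  *%R (Num.conj \; *%R) hsum_inner.
Proof.
split=> [u a x y|u a x y]; rewrite /hsum_inner/=.
  by rewrite !linearDl/= !linearZl_LR/= mulrDr addrACA.
by rewrite !linearDr/= !linearZr_LR/= mulrDr addrACA.
Qed.

HB.instance Definition _ := bilinear_isBilinear.Build R[i] hsum hsum R[i]
  *%R (Num.conj \; *%R) hsum_inner hsum_inner_bilinear.

Let hsum_inner_hermitian x y :
  hsum_inner x y = (-1) ^+ false * Num.conj (hsum_inner y x).
Proof.
rewrite expr0 mul1r rmorphD/= /hsum_inner.
by congr (_ + _); rewrite [LHS]hermC expr0 mul1r.
Qed.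

HB.instance Definition _ := isHermitianSesquilinear.Build R[i] hsum false
  Num.conj hsum_inner hsum_inner_hermitian.

Let hsum_sqr_norm_inner x : `|x| ^+ 2 = hsum_inner x x.
Proof.
rewrite /hsum_inner -!sqr_norm_inner -!rnormE -!rmorphXn -rmorphD/=.
by rewrite sqr_rnorm_hsum.
Qed.

Let hsum_inner_gt0 x : x != 0 -> 0 < hsum_inner x x.
Proof. by move=> x0; rewrite -hsum_sqr_norm_inner exprn_gt0// normr_gt0. Qed.

HB.instance Definition _ :=
  isDotProduct.Build R[i] hsum hsum_inner hsum_inner_gt0.

HB.instance Definition _ :=
  NormedModule_isHilbert.Build R hsum hsum_sqr_norm_inner.

End DirectSum.

(** * Bounded operators, the operator norm and the polynomial calculus *)

Section BoundedOperators.
Variables (R : realType) (H : hilbertType R).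
Implicit Types (S P T U : H -> H) (x : H) (p : {poly {poly R[i]}}).

(** The bound in [bounded_linear] carries no sign, and on the zero space it may be negative;
    [Num.max 0 M] repairs this. *)
Lemma bounded_linear_ge0 T : bounded_linear T ->
  exists2 M, 0 <= M & forall x, rnorm (T x) <= M * rnorm x.
Proof.
move=> [_ [M TM]]; exists (Num.max 0 M); first by rewrite le_max lexx.
move=> x; apply: le_trans (TM x) _.
by rewrite ler_wpM2r ?rnorm_ge0// le_max lexx orbT.
Qed.

Lemma linearP_0 T : linear T -> T 0 = 0.
Proof. by move=> /zmod_morphism_linear/(_ 0 0); rewrite !subrr. Qed.

Lemma linearP_B T : linear T -> {morph T : x y / x - y}.
Proof. by move=> linT x y; exact: (zmod_morphism_linear linT). Qed.

Lemma linearP_D T : linear T -> {morph T : x y / x + y}.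
Proof. by move=> linT x y; have := linT 1 x y; rewrite !scale1r. Qed.

Lemma linearP_Z T a : linear T -> {morph T : x / a *: x}.
Proof. by move=> linT x; exact: (scalable_linear linT). Qed.

(** A nonzero [x] is scaled to norm 1. Boundedness of [T] is what makes the supremum in [opnorm] an
    upper bound, as [sup] takes a default value on unbounded sets. *)
Lemma opnorm_ub T x : bounded_linear T -> rnorm (T x) <= opnorm T * rnorm x.
Proof.
move=> Tb; have [linT _] := Tb; have [M M0 TM] := bounded_linear_ge0 Tb.
have [->|x0] := eqVneq x 0; first by rewrite linearP_0// !rnorm0 mulr0.
have nx0 : 0 < rnorm x.
  by rewrite lt_def rnorm_ge0 andbT; apply: contra_neq x0 => /rnorm_eq0.
rewrite -ler_pdivrMr//.
have -> : rnorm (T x) / rnorm x = rnorm (T ((rnorm x)^-1%:C *: x)).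
  rewrite linearP_Z// rnormZ mulrC; congr (_ * _).
  by rewrite /rnorm ger0_norm//= lecR invr_ge0 rnorm_ge0.
apply: ub_le_sup.
  exists M => _ [y /= y1 <-]; apply: le_trans (TM y) _.
  by rewrite ler_piMr.
exists ((rnorm x)^-1%:C *: x) => //=; rewrite rnormZ.
rewrite [X in X * _]/rnorm ger0_norm ?lecR ?invr_ge0 ?rnorm_ge0//=.
by rewrite mulVf// gt_eqF.
Qed.

Lemma opnorm_ge0 T : bounded_linear T -> 0 <= opnorm T.
Proof.
move=> Tb; have [M M0 TM] := bounded_linear_ge0 Tb.
have [linT _] := Tb; apply: ub_le_sup.
  exists M => _ [y /= y1 <-]; apply: le_trans (TM y) _.
  by rewrite ler_piMr.
by exists 0; rewrite /= ?linearP_0// rnorm0.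
Qed.

Lemma opnorm_le T M : 0 <= M -> (forall x, rnorm (T x) <= M * rnorm x) ->
  opnorm T <= M.
Proof.
move=> M0 TM; apply: ge_sup.
  by exists (rnorm (T 0)), 0; rewrite //= rnorm0.
by move=> _ [y /= y1 <-]; apply: le_trans (TM y) _; rewrite ler_piMr.
Qed.

Lemma bounded_linear_id : bounded_linear (@idfun H).
Proof. by split=> //; exists 1 => x; rewrite mul1r. Qed.

Lemma bounded_linear_comp T U :
  bounded_linear T -> bounded_linear U -> bounded_linear (T \o U).
Proof.
move=> Tb [linU [N UN]]; have [linT _] := Tb.
have [M M0 TM] := bounded_linear_ge0 Tb.
split=> [a x y/=|]; first by rewrite linU linT.
by exists (M * N) => x; apply: le_trans (TM _) _; rewrite -mulrA ler_wpM2l.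
Qed.

Lemma bounded_linearD T U :
  bounded_linear T -> bounded_linear U -> bounded_linear (T \+ U).
Proof.
move=> [linT [M TM]] [linU [N UN]]; split=> [a x y/=|].
  by rewrite linT linU scalerDr addrACA.
by exists (M + N) => x; rewrite mulrDl (le_trans (ler_rnormD _ _))// lerD.
Qed.

Lemma bounded_linearZ (a : R[i]) T :
  bounded_linear T -> bounded_linear (fun x => a *: T x).
Proof.
move=> [linT [M TM]]; split=> [b x y/=|].
  by rewrite linT scalerDr !scalerA mulrC.
exists (rnorm a * M) => x; rewrite rnormZ -mulrA ler_wpM2l//.
exact: rnorm_ge0.
Qed.

Lemma bounded_linear_sum (I : Type) (r : seq I) (F : I -> H -> H) :
  (forall i, bounded_linear (F i)) ->
  bounded_linear (fun x => \sum_(i <- r) F i x).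
Proof.
move=> Fb; elim: r => [|i r IH].
  split=> [a x y|]; first by rewrite !big_nil scaler0 addr0.
  by exists 0 => x; rewrite big_nil rnorm0 mul0r.
rewrite (_ : (fun _ => _) = F i \+ (fun x => \sum_(i <- r) F i x)).
  exact: bounded_linearD.
by apply/funext => x; rewrite big_cons.
Qed.

Lemma bounded_linear_iter n T : bounded_linear T -> bounded_linear (iter n T).
Proof.
move=> Tb; elim: n => [|n IH]; first exact: bounded_linear_id.
exact: bounded_linear_comp.
Qed.

Lemma bounded_linear_poly_op p S P :
  bounded_linear S -> bounded_linear P -> bounded_linear (poly_op p S P).
Proof.
move=> Sb Pb; do 2 apply: bounded_linear_sum => ?.
apply/bounded_linearZ/(@bounded_linear_comp (iter _ S) (iter _ P));
  exact: bounded_linear_iter.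
Qed.

Lemma poly_op1 S P : poly_op 1 S P = idfun.
Proof.
apply/funext => x; rewrite /poly_op polyseq1 big_ord1/= polyseq1 big_ord1/=.
by rewrite scale1r.
Qed.

(** Exhibits [S] as a value of the polynomial calculus, so that its norm can be estimated on
    [Gamma]. *)
Lemma poly_opX S P : poly_op 'X S P = S.
Proof.
apply/funext => x; rewrite /poly_op polyseqX !big_ord_recl big_ord0/=.
by rewrite !(polyseq0, polyseq1) !big_ord_recl !big_ord0/= scale1r !addr0 add0r.
Qed.

End BoundedOperators.

(** * Two copies of an operator on [H (+) H], and the first summand as a reducing subspace *)

Section DirectSumOperators.
Variables (R : realType) (H : hilbertType R).
Implicit Types (S P T U : H -> H) (x y : hsum H H) (p : {poly {poly R[i]}}).

Definition dsum T x : hsum H H := (T x.1, T x.2).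

Lemma rnorm_dsum_le T M : 0 <= M -> (forall h, rnorm (T h) <= M * rnorm h) ->
  forall x, rnorm (dsum T x) <= M * rnorm x.
Proof.
move=> M0 TM x; rewrite !rnorm_hsum -[M in leRHS]ger0_norm// -sqrtr_sqr.
rewrite -sqrtrM ?sqr_ge0// ler_wsqrtr// mulrDr -!exprMn lerD//;
  by rewrite lerXn2r ?nnegrE ?mulr_ge0 ?rnorm_ge0 ?TM.
Qed.

Lemma bounded_linear_dsum T : bounded_linear T -> bounded_linear (dsum T).
Proof.
move=> Tb; have [linT _] := Tb; have [M M0 TM] := bounded_linear_ge0 Tb.
split; first by move=> a x y; rewrite /dsum/= !linT.
by exists M; exact: rnorm_dsum_le.
Qed.

Lemma opnorm_dsum_le T : bounded_linear T -> opnorm (dsum T) <= opnorm T.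
Proof.
move=> Tb; apply: opnorm_le; first exact: opnorm_ge0.
by apply: rnorm_dsum_le => [|h]; [exact: opnorm_ge0|exact: opnorm_ub].
Qed.

Lemma iter_dsum n T : iter n (dsum T) = dsum (iter n T).
Proof.
by apply/funext => -[x1 x2]; elim: n => //= n ->.
Qed.

Lemma hsum_sumE (I : Type) (r : seq I) (F : I -> hsum H H) :
  \sum_(i <- r) F i = (\sum_(i <- r) (F i).1, \sum_(i <- r) (F i).2).
Proof.
by elim: r => [|i r IH]; rewrite !(big_nil, big_cons)// IH.
Qed.

Lemma poly_op_dsum p S P :
  poly_op p (dsum S) (dsum P) = dsum (poly_op p S P).
Proof.
apply/funext => x; rewrite /poly_op hsum_sumE; congr pair;
  by apply: eq_bigr => i _; rewrite hsum_sumE; apply: eq_bigr => j _;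
     rewrite !iter_dsum.
Qed.

(** The Koszul complex of the doubled pair is, after reordering coordinates, the sum of two copies
    of the original one, so exactness is checked on each copy. *)
Lemma koszul_exact_dsum S P :
  koszul_exact S P -> koszul_exact (dsum S) (dsum P).
Proof.
case=> /seteqP[K0 K0'] /seteqP[K1 K1'] /seteqP[_ K2].
(* [S] and [P] are not assumed linear here; that they fix 0 is read off from exactness at the left
   end. *)
have [S0 P0] : S 0 = 0 /\ P 0 = 0 by have [] := K0' 0 erefl.
split; apply/seteqP; split.
- move=> [x1 x2] /= [S1 S2 P1 P2]; congr pair; apply: K0 => /=;
    by rewrite /koszul0 ?(S1, S2, P1, P2).
- by move=> _ -> /=; rewrite /koszul0 /dsum/= S0 P0.
- move=> [[a1 a2] [b1 b2]] [e1 e2].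
  have [x1 _ [<- <-]] := K1 (a1, b1) e1.
  have [x2 _ [<- <-]] := K1 (a2, b2) e2.
  by exists (x1, x2).
- move=> _ [[x1 x2] _ <-].
  have e1 : koszul1 S P (koszul0 S P x1) = 0 by apply: K1'; exists x1.
  have e2 : koszul1 S P (koszul0 S P x2) = 0 by apply: K1'; exists x2.
  exact: (congr2 pair e1 e2).
- by [].
- move=> [y1 y2] _.
  have [[a1 b1] _ e1] := K2 y1 I; have [[a2 b2] _ e2] := K2 y2 I.
  by exists ((a1, a2), (b1, b2)) => //; rewrite -e1 -e2.
Qed.

Lemma taylor_spectrum_dsum S P :
  taylor_spectrum (dsum S) (dsum P) `<=` taylor_spectrum S P.
Proof. by move=> z nexact ex; exact/nexact/(koszul_exact_dsum ex). Qed.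

(** The polynomial calculus commutes with doubling, so the doubled [Q] inverts the doubled
    denominator. *)
Lemma is_rat_op_dsum p q S P F :
  is_rat_op p q S P F -> is_rat_op p q (dsum S) (dsum P) (dsum F).
Proof.
move=> [Q [Qb qQ Qq ->]]; exists (dsum Q); rewrite !poly_op_dsum; split=> //.
- exact: bounded_linear_dsum.
- by case=> x1 x2; rewrite /dsum/= !qQ.
- by case=> x1 x2; rewrite /dsum/= !Qq.
Qed.

Lemma is_rat_op_bounded p q S P F : bounded_linear S -> bounded_linear P ->
  is_rat_op p q S P F -> bounded_linear F.
Proof.
move=> Sb Pb [Q [Qb _ _ ->]].
by apply: bounded_linear_comp => //; exact: bounded_linear_poly_op.
Qed.

(** Doubling enlarges neither the Taylor spectrum nor the norm of any rational function of the
    pair. *)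
Lemma Gamma_contraction_dsum S P :
  Gamma_contraction S P -> Gamma_contraction (dsum S) (dsum P).
Proof.
move=> [Sb Pb SP spec rat]; split; [exact: bounded_linear_dsum..| | |].
- apply/funext => x; rewrite /dsum/=.
  by congr pair; [exact: (congr1 (@^~ x.1) SP)|exact: (congr1 (@^~ x.2) SP)].
- by move=> z /taylor_spectrum_dsum/spec.
- move=> p q q0; have [F pqF Fle] := rat p q q0; exists (dsum F).
    exact: is_rat_op_dsum.
  apply: le_trans Fle; apply: opnorm_dsum_le.
  exact: is_rat_op_bounded pqF.
Qed.

Definition inl_hsum (h : H) : hsum H H := (h, 0).

Lemma range_inl_hsum : range inl_hsum = [set x | x.2 = 0].
Proof.
by apply/seteqP; split=> [_ [h _ <-]//|[x1 x2]/= ->]; exists x1.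
Qed.

Lemma orthocomplement_inl_hsum :
  orthocomplement (range inl_hsum) = [set x | x.1 = 0].
Proof.
apply/seteqP; split=> [x xJ|x /= x1 _ [h _ <-]].
  apply/eqP; rewrite -(dnorm_eq0 (@inner R H)).
  (* Testing orthogonality against the first component of [x] itself makes its squared norm
     vanish. *)
  have := xJ (inl_hsum x.1) (imageT _ _).
  by rewrite {1}/inner/= /hsum_inner/= linear0r addr0 => ->.
by rewrite {1}/inner/= /hsum_inner/= linear0r addr0 x1 linear0l.
Qed.

Lemma closed_embedding_inl_hsum : closed_embedding inl_hsum.
Proof.
split.
- by move=> a x y; congr pair; rewrite /= scaler0 addr0.
- by move=> x y; rewrite {1}/inner/= /hsum_inner/= linear0r addr0.
- rewrite range_inl_hsum.
  have snd_cont : continuous (snd : hsum H H -> H).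
    move=> x; apply/(@cvgrPdist_lt _ _ _ (nbhs x)) => e e0.
    apply/nbhs_ballP; exists e => // y.
    rewrite -ball_normE /=; exact/le_lt_trans/(norm_snd_le (x - y)).
  (* The range is the preimage of the closed set [{0}] under the continuous second projection. *)
  apply: (@closed_comp _ _ (snd : hsum H H -> H) [set 0]) => //.
  exact/accessible_closed_set1/hausdorff_accessible/norm_hausdorff.
Qed.

Lemma reducing_dsum T : linear T -> reducing (range inl_hsum) (dsum T).
Proof.
move=> linT; rewrite /reducing orthocomplement_inl_hsum range_inl_hsum.
by split=> _ [x /= x0 <-]; rewrite /= x0 linearP_0.
Qed.

End DirectSumOperators.

(** The spectral set inequality for the rational function [p / 1], in the form in which it is used:
    a bound for [p] on [Gamma] bounds [p(S, P)]. *)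
Lemma opnorm_poly_op_le (R : realType) (H : hilbertType R) (S P : H -> H)
    (p : {poly {poly R[i]}}) (M : R) : Gamma_contraction S P ->
  (forall z, Gamma R z -> rnorm p.[z.1, z.2] <= M) ->
  opnorm (poly_op p S P) <= M.
Proof.
move=> [_ _ _ _ rat] pM.
have [|F [Q [_ _ QK ->]] Fle] := rat p 1.
  by move=> z _; rewrite !hornerC oner_eq0.
(* [Q] inverts [poly_op 1 S P], which is the identity, so [Q] is the identity too. *)
have -> : poly_op p S P = poly_op p S P \o Q.
  by apply/funext => x; rewrite -{1}(QK x) poly_op1.
apply: le_trans Fle _; apply: ge_sup.
  (* Bounding a supremum from above requires a nonempty set; the point [(0, 0)] of [Gamma] provides
     an element. *)
  by exists (rnorm (p.[0, 0] / 1.[0, 0])), (0, 0) => //; exists (0, 0);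
     rewrite /= ?normr0 ?ler01 ?addr0 ?mulr0.
by move=> _ [z /pM zM <-]; rewrite !hornerC divr1.
Qed.

(** * The commuting operators [h (+) h + a D] with [D = [[0, I], [A, 0]]] *)

Section Dilation.
Variables (R : realType) (H : hilbertType R) (h A : H -> H).
Hypotheses (hb : bounded_linear h) (Ab : bounded_linear A).
Hypothesis hA : commuting h A.
Implicit Types (a b : R[i]) (x : hsum H H).

(** The block matrix [D = [[0, I], [A, 0]]], a square root of [A (+) A]. *)
Definition offdiag x : hsum H H := (x.2, A x.1).

(* The two roots of the operator polynomial [(T - dsum h)^2 - dsum A] are
   obtained for [a = 1] and [a = -1]. *)
Definition droot a : hsum H H -> hsum H H :=
  dsum h \+ (fun x => a *: offdiag x).

Lemma bounded_linear_offdiag : bounded_linear offdiag.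
Proof.
have [linA _] := Ab; have [M M0 AM] := bounded_linear_ge0 Ab.
split; first by move=> a x y; rewrite /offdiag/= linA.
(* A crude constant suffices for boundedness: the identity block contributes 1 and [A] contributes
   [M]. The sharp estimate for contractive [A] is [rnorm_offdiag_le]. *)
exists (M + 1) => x; have [r1 r2] := (rnorm_ge0 x.1, rnorm_ge0 x.2).
have r := rnorm_ge0 (x : hsum H H).
have le1 : rnorm x.1 <= rnorm x by rewrite -lecR !rnormE norm_fst_le.
have le2 : rnorm x.2 <= rnorm x by rewrite -lecR !rnormE norm_snd_le.
have : rnorm (offdiag x) <= rnorm x.2 + rnorm (A x.1).
  by rewrite -lecR rmorphD/= !rnormE; exact: (norm_hsum_le (offdiag x)).
move: (AM x.1); nra.
Qed.

Lemma rnorm_offdiag_le x : (forall u, rnorm (A u) <= rnorm u) ->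
  rnorm (offdiag x) <= rnorm x.
Proof.
move=> A1; rewrite !rnorm_hsum ler_wsqrtr//= addrC lerD//.
by rewrite lerXn2r ?nnegrE ?rnorm_ge0.
Qed.

Lemma bounded_linear_droot a : bounded_linear (droot a).
Proof.
apply: bounded_linearD; first exact: bounded_linear_dsum.
exact/bounded_linearZ/bounded_linear_offdiag.
Qed.

(** The diagonal part and the off-diagonal part contribute at most 1 each. *)
Lemma opnorm_droot_le a : rnorm a <= 1 ->
  (forall u, rnorm (h u) <= rnorm u) -> (forall u, rnorm (A u) <= rnorm u) ->
  opnorm (droot a) <= 2.
Proof.
move=> a1 h1 A1; apply: opnorm_le => // x; apply: le_trans (ler_rnormD _ _) _.
rewrite rnormZ mulrDl mul1r lerD//.
  by rewrite -[leRHS]mul1r; apply: rnorm_dsum_le => // u; rewrite mul1r.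
rewrite -[leRHS]mul1r ler_pM ?rnorm_ge0 ?rnorm_offdiag_le//.
Qed.

Lemma drootD a x : (droot a \+ droot (- a)) x = dsum (fun u => h u + h u) x.
Proof. by rewrite /droot/= scaleNr addrACA subrr addr0. Qed.

(** The block form of [h^2 + (a + b) h D + a b D^2], where [hA] moves [h] past [D]. General [a] and
    [b] serve twice: symmetry in them gives commutation, and [a = 1], [b = -1] gives the product. *)
Lemma droot_comp a b x : droot a (droot b x) =
  (h (h x.1) + (a + b) *: h x.2 + (a * b) *: A x.1,
   h (h x.2) + (a + b) *: h (A x.1) + (a * b) *: A x.2).
Proof.
have [[linh _] [linA _]] := (hb, Ab).
have hAE u : A (h u) = h (A u) by exact: (congr1 (@^~ u) (esym hA)).
rewrite /droot/= /dsum /offdiag/=; congr pair => /=.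
  rewrite (linearP_D linh) (linearP_Z _ linh) scalerDr scalerA scalerDl !addrA.
  by congr (_ + _); rewrite -!addrA; congr (_ + _); rewrite addrC.
rewrite (linearP_D linh) (linearP_Z _ linh) (linearP_D linA) (linearP_Z _ linA).
rewrite scalerDr scalerA hAE scalerDl !addrA.
by congr (_ + _); rewrite -!addrA; congr (_ + _); rewrite addrC.
Qed.

Lemma commuting_droot a b : commuting (droot a) (droot b).
Proof. by apply/funext => x; rewrite /= !droot_comp (addrC a) (mulrC a). Qed.

Lemma droot_compN x :
  (droot 1 \o droot (- 1)) x = dsum (fun u => h (h u) - A u) x.
Proof.
by rewrite /= droot_comp subrr !scale0r !addr0 mul1r !scaleN1r.
Qed.

End Dilation.

(** * The discriminant polynomial, its operator value and its bound on [Gamma] *)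

Section Discriminant.
Variables (R : realType) (H : hilbertType R).
Implicit Types S P : H -> H.

(* [s^2 / 4 - p], which equals [((z1 - z2) / 2)^2] at [(z1 + z2, z1 * z2)]. *)
Definition discr_poly : {poly {poly R[i]}} := Poly [:: - 'X; 0; 4^-1%:P].

Lemma discr_polyE (s p : R[i]) : discr_poly.[s, p] = 4^-1 * s ^+ 2 - p.
Proof.
by rewrite /discr_poly horner_Poly/= !hornerE/=; ring.
Qed.

Lemma poly_op_discr S P x : poly_op discr_poly S P x = 4^-1 *: S (S x) - P x.
Proof.
have n4 : (4^-1 : R[i]) != 0 by rewrite invr_eq0 pnatr_eq0.
(* The leading coefficient is nonzero, so the list given to [Poly] is already the coefficient
   sequence and the sums over it can be unfolded. *)
rewrite /poly_op /discr_poly (@PolyK _ 0)/= ?polyC_eq0//.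
rewrite !big_ord_recl big_ord0/= size_polyN size_polyX polyseq0 polyseqC n4/=.
rewrite !big_ord_recl !big_ord0 !coefN !coefX /bump/= mulr0n mulr1n.
by rewrite oppr0 scale0r scaleN1r !add0r !addr0 addrC.
Qed.

Lemma rnorm_discr_le (z : R[i] * R[i]) :
  Gamma R z -> rnorm discr_poly.[z.1, z.2] <= 1.
Proof.
move=> [[z1 z2] /= [z1le z2le] <-] /=; rewrite discr_polyE.
rewrite (_ : _ - _ = ((z1 - z2) / 2) ^+ 2); last by field.
rewrite -lecR rnormE normrX expr_le1// normf_div (@ger0_norm _ 2)//.
by rewrite ler_pdivrMr// mul1r (le_trans (ler_normB _ _))// lerD.
Qed.

End Discriminant.

(** * Construction of [T1] and [T2] from [S / 2] and the discriminant operator *)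

Theorem theorem1p3 (R : realType) (H : hilbertType R) (S P : H -> H)
    (hSP : Gamma_contraction S P) :
  exists (K : hilbertType R) (J : H -> K) (T1 T2 : K -> K),
    [/\ closed_embedding J,
        [/\ bounded_linear T1, bounded_linear T2 & commuting T1 T2],
        Gamma_contraction (T1 \+ T2) (T1 \o T2),
        reducing (range J) (T1 \+ T2) /\ reducing (range J) (T1 \o T2)
      & (forall x, (T1 \+ T2) (J x) = J (S x)) /\
        (forall x, (T1 \o T2) (J x) = J (P x))] /\
    Num.max (opnorm T1) (opnorm T2) <= 2.
Proof.
have [Sb Pb SP _ _] := hSP.
have [[linS _] [linP _]] := (Sb, Pb).
(* [A] is taken as a value of the polynomial calculus, so that the spectral set inequality applies
   to it directly. *)
pose h x := 2^-1 *: S x; pose A := poly_op (discr_poly R) S P.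
have hb : bounded_linear h by exact: bounded_linearZ.
have Ab : bounded_linear A by exact: bounded_linear_poly_op.
have SPE u : S (P u) = P (S u) by exact: (congr1 (@^~ u) SP).
have hA : commuting h A.
  apply/funext => u; rewrite /h /A/= !poly_op_discr.
  rewrite (linearP_B linS) !(linearP_Z _ linS) (linearP_Z _ linP) SPE scalerBr.
  by rewrite !scalerA mulrC.
(* The outer variable evaluates to [z1 + z2] on [Gamma], which has modulus at most 2. *)
have S2 : opnorm S <= 2.
  rewrite -(poly_opX S P); apply: opnorm_poly_op_le => //.
  move=> _ [[z1 z2] /= [z1le z2le] <-] /=.
  rewrite hornerX hornerC -lecR rnormE (le_trans (ler_normD _ _))//.
  by rewrite rmorph_nat lerD.
have A1 : opnorm A <= 1.
  by apply: (opnorm_poly_op_le hSP); exact: (@rnorm_discr_le R).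
have A1u u : rnorm (A u) <= rnorm u.
  by apply: le_trans (opnorm_ub _ Ab) _; rewrite ler_piMl ?rnorm_ge0.
have h1 u : rnorm (h u) <= rnorm u.
  have r2 : rnorm (2^-1 : R[i]) = 2^-1.
    by apply: (@complexI R); rewrite rnormE normfV normr_nat fmorphV rmorph_nat.
  rewrite rnormZ r2 mulrC ler_pdivrMr// mulrC.
  by apply: le_trans (opnorm_ub u Sb) _; rewrite ler_wpM2r ?rnorm_ge0.
have sumE : droot h A 1 \+ droot h A (- 1) = dsum S.
  apply/funext => x; rewrite drootD; congr dsum; apply/funext => u.
  rewrite /h -scalerDl (_ : 2^-1 + 2^-1 = 1) ?scale1r//; by field.
(* Here [h^2 - A = S^2 / 4 - (S^2 / 4 - P) = P]. *)
have compE : droot h A 1 \o droot h A (- 1) = dsum P.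
  apply/funext => x; rewrite droot_compN//; congr dsum; apply/funext => u.
  rewrite /h /A poly_op_discr (linearP_Z _ linS) scalerA.
  have -> : 2^-1 * 2^-1 = 4^-1 :> R[i] by field.
  by rewrite opprB addrC subrK.
exists (hsum H H), (@inl_hsum R H), (droot h A 1), (droot h A (- 1)).
(* Once the sum and the product are replaced by [dsum S] and [dsum P], the claims about them are
   facts about doubled operators; the norm bounds use that both signs have modulus 1. *)
rewrite sumE compE ge_max !opnorm_droot_le//; last 2 first.
  by rewrite rnormN -lecR rnormE normr1.
  by rewrite -lecR rnormE normr1.
split=> //; split.
- exact: closed_embedding_inl_hsum.
- by split; [exact: bounded_linear_droot..|exact: commuting_droot].
- exact: Gamma_contraction_dsum.
- by split; exact: reducing_dsum.
- by split=> u; rewrite /dsum/= linearP_0.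
Qed.
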